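(* Let $\nabla$ be a nonzero flat torsion-free connection on the $2$-dimensional abelian Lie algebra $\mathbb{R}^2$ and $\omega$ a symplectic form on $\mathbb{R}^2$ with $\nabla\omega=0$. Then there is a basis $\{e_1,e_2\}$ of $\mathbb{R}^2$, with dual basis $\{e^1,e^2\}$, such that $(\nabla,\omega)$ is symplectically equivalent to $(\nabla^0,e^1\wedge e^2)$, where $\nabla^0$ is the connection given by $$\nabla^0_{e_1}e_1=e_2,\quad \nabla^0_{e_1}e_2=0,\quad \nabla^0_{e_2}\equiv 0.$$ This flat torsion-free connection $\nabla^0$ on $\mathbb{R}^2$ is complete.
   Context: A connection on a real Lie algebra $\mathfrak h$ is a bilinear map $\nabla:\mathfrak h\times\mathfrak h\to\mathfrak h$, $(x,y)\mapsto\nabla_xy$; it is torsion-free if $\nabla_xy-\nabla_yx=[x,y]$ and flat if $\nabla_x\nabla_y-\nabla_y\nabla_x=\nabla_{[x,y]}$ for all $x,y$. A symplectic form is a nondegenerate 2-form $\omega$ that is closed, i.e. $-\omega([x,y],z)+\omega([x,z],y)-\omega([y,z],x)=0$ for all $x,y,z$ (automatic for abelian $\mathfrak h$). $\nabla\omega=0$ means $\omega(\nabla_xy,z)=\omega(\nabla_xz,y)$ for all $x,y,z\in\mathfrak h$. Pairs $(\nabla,\omega)$ on $\mathfrak h$ and $(\nabla',\omega')$ on $\mathfrak h'$ (each consisting of a connection and a symplectic form parallel for it) are symplectically equivalent if there is a Lie algebra isomorphism $\xi:\mathfrak h\to\mathfrak h'$ with $\xi\nabla_xy=\nabla'_{\xi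 x}\xi y$ and $\omega(x,y)=\omega'(\xi x,\xi y)$ for all $x,y\in\mathfrak h$. A connection $\nabla$ on $\mathfrak h$ is complete if all solutions $x(t)\in\mathfrak h$ of the differential equation $\dot x(t)=-\nabla_{x(t)}x(t)$ are defined for all $t\in\mathbb R$ (this is equivalent to geodesic completeness of the corresponding left-invariant connection on a Lie group with Lie algebra $\mathfrak h$). *)

(* Defs.v *)
From HB Require Import structures.
From mathcomp Require Import all_boot all_order all_algebra sesquilinear.
From mathcomp Require Import all_classical all_reals all_analysis.
From mathcomp Require Import ring.

Set Implicit Arguments.
Unset Strict Implicit.
Unset Printing Implicit Defensive.

Import Order.TTheory GRing.Theory Num.Theory.
Import numFieldNormedType.Exports.
Local Open Scope classical_set_scope.
Local Open Scope ring_scope.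

Record lie_bracket (R : realType) (V : lmodType R) := LieBracket {
  lie_fun :> {bilinear V -> V -> V};
  lie_alt : forall x, lie_fun x x = 0;
  lie_jacobi : forall x y z,
    lie_fun x (lie_fun y z) + lie_fun y (lie_fun z x)
      + lie_fun z (lie_fun x y) = 0 }.

Definition zero_bracket (R : realType) (V : lmodType R) (_ _ : V) : V := 0.

Lemma zero_bracket_bilinear (R : realType) (V : lmodType R) :
  bilinear_for *:%R *:%R (@zero_bracket R V).
Proof. by split=> u a x y /=; rewrite /zero_bracket scaler0 addr0. Qed.

HB.instance Definition _ (R : realType) (V : lmodType R) :=
  bilinear_isBilinear.Build R V V V *:%R *:%R (@zero_bracket R V)
    (@zero_bracket_bilinear R V).

Lemma zero_bracket_alt (R : realType) (V : lmodType R) (x : V) :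
  zero_bracket x x = 0.
Proof. by []. Qed.

Lemma zero_bracket_jacobi (R : realType) (V : lmodType R) (x y z : V) :
  zero_bracket x (zero_bracket y z) + zero_bracket y (zero_bracket z x)
    + zero_bracket z (zero_bracket x y) = 0.
Proof. by rewrite /zero_bracket !addr0. Qed.

Definition abelian_lie (R : realType) (V : lmodType R) : lie_bracket V :=
  LieBracket (lie_fun := @zero_bracket R V)
    (@zero_bracket_alt R V) (@zero_bracket_jacobi R V).

(* A connection is a term [nabla : {bilinear V -> V -> V}]; [nabla x y] is
   nabla_x y. *)
Definition torsion_free (R : realType) (V : lmodType R) (L : lie_bracket V)
    (nabla : {bilinear V -> V -> V}) : Prop :=
  forall x y, nabla x y - nabla y x = L x y.

Definition flat (R : realType) (V : lmodType R) (L : lie_bracket V)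
    (nabla : {bilinear V -> V -> V}) : Prop :=
  forall x y z, nabla x (nabla y z) - nabla y (nabla x z) = nabla (L x y) z.

Definition symplectic_form (R : realType) (V : lmodType R) (L : lie_bracket V)
    (omega : {biscalar V}) : Prop :=
  [/\ forall x, omega x x = 0,
      forall x, (forall y, omega x y = 0) -> x = 0
    & forall x y z,
        - omega (L x y) z + omega (L x z) y - omega (L y z) x = 0].

Definition parallel (R : realType) (V : lmodType R)
    (nabla : {bilinear V -> V -> V}) (omega : {biscalar V}) : Prop :=
  forall x y z, omega (nabla x y) z = omega (nabla x z) y.

Definition symplectic_pair (R : realType) (V : lmodType R) (L : lie_bracket V)
    (nabla : {bilinear V -> V -> V}) (omega : {biscalar V}) : Prop :=
  symplectic_form L omega /\ parallel nabla omega.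

Definition lie_isomorphism (R : realType) (V V' : lmodType R)
    (L : lie_bracket V) (L' : lie_bracket V') (xi : {linear V -> V'}) : Prop :=
  bijective xi /\ forall x y, xi (L x y) = L' (xi x) (xi y).

Definition symplectically_equivalent (R : realType) (V V' : lmodType R)
    (L : lie_bracket V) (nabla : {bilinear V -> V -> V}) (omega : {biscalar V})
    (L' : lie_bracket V') (nabla' : {bilinear V' -> V' -> V'})
    (omega' : {biscalar V'}) : Prop :=
  [/\ symplectic_pair L nabla omega,
      symplectic_pair L' nabla' omega'
    & exists xi : {linear V -> V'},
      [/\ lie_isomorphism L L' xi,
          forall x y, xi (nabla x y) = nabla' (xi x) (xi y)
        & forall x y, omega x y = omega' (xi x) (xi y)]].

Definition geodesic_solution (R : realType) (V : normedModType R)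
    (nabla : {bilinear V -> V -> V}) (I : set R) (x : R -> V) : Prop :=
  forall t, I t -> is_derive t 1 x (- nabla (x t) (x t)).

(* Functions are total here, so a solution with domain an open interval [I] is
   only constrained on [I]; "defined for all t" means that it extends to a
   solution on the whole line. *)
Definition complete_connection (R : realType) (V : normedModType R)
    (nabla : {bilinear V -> V -> V}) : Prop :=
  forall (I : set R) (x : R -> V), open I -> is_interval I ->
    geodesic_solution nabla I x ->
    exists y : R -> V,
      (forall t, I t -> y t = x t) /\ geodesic_solution nabla setT y.

Definition wedge (R : realType) (V : lmodType R) (f g : {scalar V})
    (x y : V) : R := f x * g y - f y * g x.

Lemma wedge_bilinear (R : realType) (V : lmodType R) (f g : {scalar V}) :
  bilinear_for *%R *%R (wedge f g).
Proof.
by split=> u a x y /=; rewrite /wedge !linearP /=; ring.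
Qed.

HB.instance Definition _ (R : realType) (V : lmodType R) (f g : {scalar V}) :=
  bilinear_isBilinear.Build R V V R *%R *%R (wedge f g) (wedge_bilinear f g).

(* The table of nabla^0 in the basis e_1 = e`_0, e_2 = e`_1; it determines
   [nabla0] by bilinearity. *)
Definition is_nabla0 (R : realType) (e : 2.-tuple 'rV[R]_2)
    (nabla0 : {bilinear 'rV[R]_2 -> 'rV[R]_2 -> 'rV[R]_2}) : Prop :=
  [/\ nabla0 e`_0 e`_0 = e`_1,
      nabla0 e`_0 e`_1 = 0
    & forall y, nabla0 e`_1 y = 0].

(* Main.v *)
Require Import Defs.
From mathcomp Require Import all_boot all_order all_algebra sesquilinear.
From mathcomp Require Import all_classical all_reals all_analysis.
From mathcomp Require Import ring lra.
Import Order.TTheory GRing.Theory Num.Theory.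
Import numFieldNormedType.Exports.
Local Open Scope classical_set_scope.
Local Open Scope ring_scope.

(** On an abelian Lie algebra, torsion-freeness says that [nabla] is symmetric,
    and together with parallelism of [omega] this makes the trilinear form
    S(x, y, z) = omega(nabla_x y, z) totally symmetric.  By nondegeneracy of
    [omega], S determines [nabla], so a nonzero [nabla] has a nonzero cubic
    form v |-> S(v, v, v) ([cubic_neq0]); as real numbers have real cube roots,
    some u satisfies S(u, u, u) = -1 ([cubic_eqN1]).  Then
    omega(u, nabla_u u) = 1, so e_1 = u and e_2 = nabla_u u form a symplectic
    basis in which nabla_(e_1) e_1 = e_2 holds by construction.  The two
    components of S that are still unknown, S(e_1, e_2, e_2) and
    S(e_2, e_2, e_2), are killed by the single flatness equation
    nabla_(e_1) nabla_(e_2) e_1 = nabla_(e_2) nabla_(e_1) e_1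
    ([is_nabla0_of_flat]).  Hence [nabla] is itself nabla^0 in this basis and
    the equivalence is the identity map.

    Conversely nabla^0_x y = x_1 y_1 e_2 ([nabla0E]), which is symmetric in x
    and y; as its first coordinate is zero, nabla^0_x nabla^0_y = 0.  This gives
    torsion-freeness and flatness.  Along a solution x of the geodesic equation
    the first coordinate is constant, so w = nabla^0_x x is a constant vector
    and x is the affine motion x(t_0) - (t - t_0) w, which extends to the whole
    line ([nabla0_complete]). *)

(** * Connections on abelian Lie algebras *)

Lemma abelian_torsion_freeE {R : realType} (V : lmodType R)
    (nabla : {bilinear V -> V -> V}) :
  torsion_free (abelian_lie V) nabla <-> forall x y, nabla x y = nabla y x.
Proof.
split=> H x y; last by rewrite (H x y) subrr.
by apply/eqP; rewrite -subr_eq0; apply/eqP/H.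
Qed.

Lemma abelian_flatE {R : realType} (V : lmodType R)
    (nabla : {bilinear V -> V -> V}) :
  flat (abelian_lie V) nabla <->
  forall x y z, nabla x (nabla y z) = nabla y (nabla x z).
Proof.
split=> H x y z.
  by apply/eqP; rewrite -subr_eq0 H /= /zero_bracket linear0l.
by rewrite /= /zero_bracket linear0l H subrr.
Qed.

Lemma alternating_anti {R : realType} (V : lmodType R) (omega : {biscalar V}) :
  (forall x, omega x x = 0) -> forall x y, omega x y = - omega y x.
Proof.
move=> alt x y; have := alt (x + y).
by rewrite linearDl !linearDr !alt add0r addr0 => /eqP; rewrite addr_eq0 => /eqP.
Qed.

(** * The cubic form of a parallel connection *)

(** If the cubic form vanished, so would its polarization; since S is totally
    symmetric, this is done in two steps, first giving nabla_v v = 0 for all v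
    and then nabla_x y = 0. *)
Lemma cubic_neq0 {R : realType} (V : lmodType R)
    (nabla : {bilinear V -> V -> V}) (omega : {biscalar V}) :
  (exists x y, nabla x y != 0) ->
  (forall x y, nabla x y = nabla y x) ->
  (forall x, (forall y, omega x y = 0) -> x = 0) ->
  parallel nabla omega ->
  exists v, omega (nabla v v) v != 0.
Proof.
move=> [x [y nz]] sym nondeg par; apply/not_existsP => Phi0.
have {}Phi0 v : omega (nabla v v) v = 0.
  by apply: contrapT => H; apply: (Phi0 v); apply/eqP.
have nablavv v : nabla v v = 0.
  apply: nondeg => w.
  (* For the cubic form Phi(u) = S(u, u, u), the identity used is
     Phi(w + v) + Phi(w - v) = 2 Phi(w) + 6 S(v, v, w). *)
  have := Phi0 (w + v); have := Phi0 (w - v).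
  rewrite !(linearDl, linearDr, linearBl, linearBr, linearNl, linearNr) /=.
  have Svwv : omega (nabla w v) v = omega (nabla v v) w by rewrite sym par.
  rewrite !Phi0 !(sym v w) !Svwv !(par w v w); lra.
have := nablavv (x + y).
rewrite !(linearDl, linearDr) /= !nablavv (sym y x) add0r addr0 -mulr2n.
move/eqP; rewrite -scaler_nat scaler_eq0 pnatr_eq0 /= => /eqP xy0.
by rewrite xy0 eqxx in nz.
Qed.

Lemma cube_root {R : realType} (c : R) : exists t : R, t ^+ 3 = c.
Proof.
wlog c0 : c / 0 <= c.
  move=> H; have [/H//|/ltW c0] := leP 0 c.
  have [|t tc] := H (- c); first by rewrite oppr_ge0.
  by exists (- t); rewrite exprNn tc -signr_odd /= expr1 mulN1r opprK.
exists (c `^ (3%:R)^-1).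
by rewrite -powR_mulrn ?powR_ge0// -powRrM mulVf ?powRr1// pnatr_eq0.
Qed.

(** The sign -1 is the one for which the pair u, nabla_u u is positively
    oriented: omega(u, nabla_u u) = - S(u, u, u) = 1. *)
Lemma cubic_eqN1 {R : realType} (V : lmodType R)
    (nabla : {bilinear V -> V -> V}) (omega : {biscalar V}) (v : V) :
  omega (nabla v v) v != 0 -> exists u, omega (nabla u u) u = -1.
Proof.
move=> nz; have [t ht] := cube_root (- (omega (nabla v v) v)^-1).
exists (t *: v).
rewrite !(linearZl_LR, linearZr_LR) /=.
rewrite /GRing.scale /= !mulrA -expr2 -exprSr ht.
by rewrite mulNr mulVf.
Qed.

(** * Symplectic bases of the plane *)

Lemma darboux_basis {R : realType} (omega : {biscalar 'rV[R]_2})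
    (u v : 'rV[R]_2) :
  (forall x, omega x x = 0) -> omega u v = 1 ->
  basis_of fullv [tuple u; v].
Proof.
move=> alt uv.
have vu : omega v u = -1 by rewrite alternating_anti// uv.
rewrite basisEfree subvf dimvf /dim /= andbT.
apply/freeP => k; rewrite big_ord_recl big_ord1 /= => k0 i.
have a := congr1 (omega^~ v) k0; have b := congr1 (omega^~ u) k0.
move: a b; rewrite /= !linearDl !linear0l !linearZl_LR /= !alt uv vu.
rewrite !mulr0 add0r addr0 mulr1 mulrN1 => a /eqP; rewrite oppr_eq0 => /eqP b.
by case: i => [[|[|//]] hi]; [rewrite -[RHS]a | rewrite -[RHS]b];
  congr k; apply: val_inj.
Qed.

Lemma basis2_expand {R : realType} (e : 2.-tuple 'rV[R]_2) (x : 'rV[R]_2) :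
  basis_of fullv e -> x = coord e 0 x *: e`_0 + coord e 1 x *: e`_1.
Proof.
move=> be; rewrite {1}(coord_basis be (memvf x)) big_ord_recl big_ord1 /=.
by congr (_ + coord e _ x *: _); apply: val_inj.
Qed.

Lemma basis2_dual {R : realType} (e : 2.-tuple 'rV[R]_2) :
  basis_of fullv e ->
  [/\ coord e 0 e`_0 = 1, coord e 0 e`_1 = 0,
      coord e 1 e`_0 = 0 & coord e 1 e`_1 = 1].
Proof.
move=> /basis_free fe.
by split; [have := coord_free 0 0 fe | have := coord_free 1 0 fe
  | have := coord_free 0 1 fe | have := coord_free 1 1 fe].
Qed.

Lemma alternating_wedge {R : realType} (omega : {biscalar 'rV[R]_2})
    (e : 2.-tuple 'rV[R]_2) :
  (forall x, omega x x = 0) -> basis_of fullv e -> omega e`_0 e`_1 = 1 ->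
  forall x y, omega x y = wedge (coord e 0) (coord e 1) x y.
Proof.
move=> alt be e01 x y.
rewrite {1}(basis2_expand _ x be) {1}(basis2_expand _ y be) /wedge.
rewrite !(linearDl, linearDr) /= !(linearZl_LR, linearZr_LR).
rewrite /GRing.scale /= !alt (alternating_anti _ _ alt e`_1 e`_0) e01; ring.
Qed.

(** Write s = S(e_1, e_2, e_2) and r = S(e_2, e_2, e_2).  The choice of e_2 makes
    S(e_1, e_1, e_2) = omega(e_2, e_2) = 0, so nabla_(e_1) e_2 = s e_1 and
    nabla_(e_2) e_2 = r e_1 - s e_2.  Flatness applied to e_1, e_2, e_1 reads
    s e_2 = r e_1 - s e_2, whence r = s = 0. *)
Lemma is_nabla0_of_flat {R : realType}
    (nabla : {bilinear 'rV[R]_2 -> 'rV[R]_2 -> 'rV[R]_2})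
    (omega : {biscalar 'rV[R]_2}) (e : 2.-tuple 'rV[R]_2) :
  (forall x y, nabla x y = nabla y x) ->
  (forall x y z, nabla x (nabla y z) = nabla y (nabla x z)) ->
  (forall x, omega x x = 0) -> parallel nabla omega ->
  basis_of fullv e -> omega e`_0 e`_1 = 1 -> e`_1 = nabla e`_0 e`_0 ->
  is_nabla0 e nabla.
Proof.
move=> sym flt alt par be e01 e1E.
have anti := alternating_anti _ _ alt.
have expand x : x = omega x e`_1 *: e`_0 + omega e`_0 x *: e`_1.
  rewrite {1}(basis2_expand _ x be); congr (_ *: _ + _ *: _).
    rewrite [in RHS](basis2_expand _ x be) linearDl !linearZl_LR /=.
    by rewrite e01 alt /GRing.scale /= mulr1 mulr0 addr0.
  rewrite [in RHS](basis2_expand _ x be) linearDr !linearZr_LR /=.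
  by rewrite e01 alt /GRing.scale /= mulr1 mulr0 add0r.
set s := omega (nabla e`_0 e`_1) e`_1.
set r := omega (nabla e`_1 e`_1) e`_1.
have n01 : nabla e`_0 e`_1 = s *: e`_0.
  by rewrite [LHS]expand -/s anti par -e1E alt oppr0 scale0r addr0.
have n11 : nabla e`_1 e`_1 = r *: e`_0 - s *: e`_1.
  by rewrite [LHS]expand -/r (anti e`_0) par (sym e`_1 e`_0) -/s scaleNr.
have := flt e`_0 e`_1 e`_0.
rewrite (sym e`_1 e`_0) n01 linearZr_LR /= -e1E n11 => key.
have s0 : s = 0.
  have := congr1 (omega e`_0) key.
  rewrite linearBr !linearZr_LR /= alt e01 /GRing.scale /= => ?; lra.
have r0 : r = 0.
  have := congr1 (omega e`_1) key.
  rewrite linearBr !linearZr_LR /= alt (anti e`_1) e01 s0 /GRing.scale /=.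
  by move=> ?; lra.
split=> [//||y]; first by rewrite n01 s0 scale0r.
rewrite (basis2_expand _ y be) linearDr !linearZr_LR /= sym n01 n11 s0 r0.
by rewrite !scale0r subr0 !scaler0 addr0.
Qed.

(** * Completeness of the normal form *)

Lemma nabla0E {R : realType} (e : 2.-tuple 'rV[R]_2)
    (nabla0 : {bilinear 'rV[R]_2 -> 'rV[R]_2 -> 'rV[R]_2}) :
  basis_of fullv e -> is_nabla0 e nabla0 ->
  forall x y, nabla0 x y = (coord e 0 x * coord e 0 y) *: e`_1.
Proof.
move=> be [n00 n01 n1] x y.
rewrite {1}(basis2_expand _ x be) {1}(basis2_expand _ y be).
rewrite !(linearDl, linearDr) /= !(linearZl_LR, linearZr_LR).
by rewrite /= n00 n01 !n1 !scaler0 !addr0 scalerA.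
Qed.

Lemma coord0_nabla0 {R : realType} (e : 2.-tuple 'rV[R]_2)
    (nabla0 : {bilinear 'rV[R]_2 -> 'rV[R]_2 -> 'rV[R]_2}) :
  basis_of fullv e -> is_nabla0 e nabla0 ->
  forall x y, coord e 0 (nabla0 x y) = 0.
Proof.
move=> be is0 x y; have [_ c01 _ _] := basis2_dual _ be.
by rewrite (nabla0E _ _ be is0) linearZ /= c01 mulr0.
Qed.

Lemma derive0_interval_cst {R : realType} (f : R -> R) (I : set R) :
  is_interval I -> (forall t, I t -> is_derive t 1 f 0) ->
  forall s t, I s -> I t -> f s = f t.
Proof.
move=> itvI df s t; wlog st : s t / s <= t.
  by move=> H Is It; have [/H|/ltW/H] := leP s t => [->//|->].
move=> Is It.
have sub z : s <= z <= t -> I z by exact: itvI.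
have [| |c _] := @MVT_segment _ f (fun=> 0) s t st.
- move=> z; rewrite in_itv /= => /andP[sz zt]; apply/df/sub.
  by rewrite !ltW.
- apply: derivable_within_continuous => z; rewrite in_itv /= => szt.
  by have [] := df z (sub z szt).
by rewrite mul0r => /eqP; rewrite subr_eq0 eq_sym => /eqP.
Qed.

(** A linear form on row vectors is a linear combination of the entries, and
    derivatives of row vectors are computed entrywise; this lets vector-valued
    equations be tested coordinate by coordinate in any basis. *)
Lemma is_derive_scalar {R : realType} {n : nat} (phi : {scalar 'rV[R]_n})
    (x : R -> 'rV[R]_n) (t : R) (d : 'rV[R]_n) :
  is_derive t 1 x d -> is_derive t 1 (phi \o x) (phi d).
Proof.
move=> [dx xd].
have phiE u : phi u = \sum_(j < n) phi (delta_mx 0 j) *: (u 0 j : R).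
  rewrite {1}[u]row_sum_delta linear_sum; apply: eq_bigr => j _.
  by rewrite linearZ /= mulrC.
have -> : phi \o x =
    \sum_(j < n) (fun t : R => phi (delta_mx 0 j) *: (x t 0 j : R)).
  by apply/funext => u; rewrite /= phiE fct_sumE.
rewrite phiE; apply: is_derive_sum => j; apply: is_deriveZ.
apply: DeriveDef; first exact: (derivable_mxP _ _ _).1.
by rewrite -xd derive_mx// mxE.
Qed.

(** The difference quotient of an affine motion is constant. *)
Lemma is_derive_ray {R : realType} {V : normedModType R} (p w : V) (s t : R) :
  is_derive t 1 (fun u => p - (u - s) *: w) (- w).
Proof.
pose f (u : R) := p - (u - s) *: w.
have fw : h^-1 *: (f (h *: 1 + t) - f t) @[h --> (0 : R)^'] --> - w.
  apply: cvg_near_cst; near=> h.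
  have h0 : h != 0 by near: h; exact: nbhs_dnbhs_neq.
  rewrite /f opprD opprK addrACA subrr add0r addrC -scalerBl.
  rewrite (_ : t - s - _ = - h); last by rewrite /GRing.scale /=; ring.
  by rewrite scaleNr scalerN scalerA mulVf// scale1r.
apply: DeriveDef; last exact: cvg_lim.
by apply/cvg_ex; exists (- w).
Unshelve. all: by end_near. Qed.

(** The first coordinate of a solution is constant because nabla^0 takes values
    in the line of e_2.  Hence nabla^0_x x is constant too, and the difference
    of x and the affine motion through x(t_0) has zero derivative. *)
Lemma nabla0_complete {R : realType} (e : 2.-tuple 'rV[R]_2)
    (nabla0 : {bilinear 'rV[R]_2 -> 'rV[R]_2 -> 'rV[R]_2}) :
  basis_of fullv e -> is_nabla0 e nabla0 -> complete_connection nabla0.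
Proof.
move=> be is0 I x _ itvI xsol.
have nE := nabla0E _ _ be is0.
have c0n := coord0_nabla0 _ _ be is0.
have [->|/set0P[t0 It0]] := eqVneq I set0.
  exists (cst 0); split=> // t _.
  by rewrite /cst linear0r oppr0; exact: is_derive_cst.
have c0 : forall t, I t -> coord e 0 (x t) = coord e 0 (x t0).
  move=> t It; apply: (@derive0_interval_cst _ (coord e 0 \o x) I) => // u Iu.
  have := is_derive_scalar (coord e 0) _ _ _ (xsol u Iu).
  by rewrite linearN /= c0n oppr0.
pose y t := x t0 - (t - t0) *: nabla0 (x t0) (x t0).
exists y; split=> [t It|t _].
  rewrite /y.
  have cst i : coord e i (x t - y t) = coord e i (x t0 - y t0).
    pose z u := coord e i (x u - y u).
    apply: (@derive0_interval_cst _ z I) => // u Iu.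
    rewrite -[0](linear0 (coord e i)); apply: is_derive_scalar.
    have := is_deriveB (xsol u Iu)
      (is_derive_ray (x t0) (nabla0 (x t0) (x t0)) t0 u).
    have -> : nabla0 (x u) (x u) = nabla0 (x t0) (x t0) by rewrite !nE c0.
    by rewrite subrr.
  have xy0 : x t - y t = 0.
    rewrite (basis2_expand _ (x t - y t) be) !cst /y subrr scale0r subr0 subrr.
    by rewrite !linear0 !scale0r addr0.
  by apply/esym/eqP; rewrite -subr_eq0; apply/eqP.
have -> : nabla0 (y t) (y t) = nabla0 (x t0) (x t0).
  have c0y : coord e 0 (y t) = coord e 0 (x t0).
    by rewrite /y -scaleNr linearD linearZ /= c0n mulr0 addr0.
  by rewrite !nE c0y.
exact: is_derive_ray.
Qed.

(** * Classification *)

Theorem proposition4p2 (R : realType) :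
  (forall (nabla : {bilinear 'rV[R]_2 -> 'rV[R]_2 -> 'rV[R]_2})
          (omega : {biscalar 'rV[R]_2}),
     (exists x y, nabla x y != 0) ->
     flat (abelian_lie 'rV[R]_2) nabla ->
     torsion_free (abelian_lie 'rV[R]_2) nabla ->
     symplectic_form (abelian_lie 'rV[R]_2) omega ->
     parallel nabla omega ->
     exists (e : 2.-tuple 'rV[R]_2)
            (nabla0 : {bilinear 'rV[R]_2 -> 'rV[R]_2 -> 'rV[R]_2}),
       [/\ basis_of fullv e,
           is_nabla0 e nabla0
         & symplectically_equivalent
             (abelian_lie 'rV[R]_2) nabla omega
             (abelian_lie 'rV[R]_2) nabla0 (wedge (coord e 0) (coord e 1))]) /\
  (forall (e : 2.-tuple 'rV[R]_2)
          (nabla0 : {bilinear 'rV[R]_2 -> 'rV[R]_2 -> 'rV[R]_2}),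
     basis_of fullv e -> is_nabla0 e nabla0 ->
     [/\ flat (abelian_lie 'rV[R]_2) nabla0,
         torsion_free (abelian_lie 'rV[R]_2) nabla0
       & complete_connection nabla0]).
Proof.
split=> [nabla omega nz /abelian_flatE flt /abelian_torsion_freeE sym symp par|
         e nabla0 be is0].
  have [alt nondeg closed] := symp.
  have [v nzv] := cubic_neq0 _ _ _ nz sym nondeg par.
  have [u uN1] := cubic_eqN1 _ _ _ _ nzv.
  have uv : omega u (nabla u u) = 1.
    by rewrite alternating_anti// uN1 opprK.
  pose e := [tuple u; nabla u u].
  have be : basis_of fullv e := darboux_basis _ _ _ alt uv.
  have omegaE := alternating_wedge omega e alt be uv.
  exists e, nabla; split=> //; first exact: (is_nabla0_of_flat _ omega).
  split=> //.
    split; last by move=> x y z; have := par x y z; rewrite !omegaE.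
    split=> [x|x xy|x y z].
    - by have := alt x; rewrite omegaE.
    - by apply: nondeg => y; rewrite omegaE; exact: xy.
    - by have := closed x y z; rewrite !omegaE.
  by exists idfun; split=> //; split=> //.
have nE := nabla0E _ _ be is0.
split; last exact: (nabla0_complete _ _ be is0).
- apply/abelian_flatE => x y z; have c0n := coord0_nabla0 _ _ be is0.
  by rewrite (nE x (nabla0 y z)) (nE y (nabla0 x z)) !c0n !mulr0.
- by apply/abelian_torsion_freeE => x y; rewrite (nE x y) (nE y x) mulrC.
Qed.
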